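(* Let $m$ be a positive integer, let $s^{-1}(m)=\max\{n\ge 0: s_n\le m\}$, and let $\phi(m)$ be the sum of the coefficients $\varepsilon_i$ in the $\mu$-expansion $m=r+\varepsilon_1\mu_1+\cdots+\varepsilon_\ell\mu_\ell$ of $m$. Then there exists an integer $r\in\{0,1,2,3,4\}$ such that \[ m-r=3s^{-1}(m)+2\phi(m). \]
   Context: Sequence $s_n$: let $A_1=(5)$ and for $k\ge2$ let $A_k$ be the concatenation $A_{k-1},A_{k-1},(1)$; $A$ is the limiting infinite list; $a_0=0$, $a_n$ is the $n$th entry of $A$ for $n\ge1$, and $s_n=a_0+\cdots+a_n$. For $i\ge1$ let $M_i=2^i-1$ and $\mu_i=3M_i+2=3\cdot 2^i-1$. The $\mu$-expansion of a positive integer $n$ is obtained greedily: if $n\le 4$, stop (remainder $r=n$, no further terms). Otherwise let $\ell=\max\{i:n\ge\mu_i\}$ and write $n=\mu_\ell+r'$ with $0\le r'\le\mu_\ell$; if $r'=0$, stop with $n=\mu_\ell$; if $r'=\mu_\ell$, stop with $n=2\mu_\ell$; otherwise continue the process with $r'$. This yields $n=r+\varepsilon_1\mu_1+\cdots+\varepsilon_\ell\mu_\ell$ with $r\in\{0,1,2,3,4\}$ and $\varepsilon_i\in\{0,1,2\}$ (and $\phi(n)=0$ if $n\le 4$). *)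

(* Defs.v *)
From mathcomp Require Import all_boot all_order all_algebra.
From mathcomp Require Import zify.

Set Implicit Arguments.
Unset Strict Implicit.
Unset Printing Implicit Defensive.

(* A_k for k >= 1; the value at k = 0 is a dummy. *)
Fixpoint blockA (k : nat) : seq nat :=
  match k with
  | 0 => [::]
  | 1 => [:: 5]
  | k'.+1 => blockA k' ++ blockA k' ++ [:: 1]
  end.

(* The n-th entry (counting from 1) of the limit list A is read off in A_n,
   which has 2^n - 1 >= n entries; by a_blockA any A_k with at least n entries
   gives the same value. *)
Definition a (n : nat) : nat :=
  if n is n'.+1 then nth 0 (blockA n) n' else 0.

Definition s (n : nat) : nat := \sum_(0 <= i < n.+1) a i.

Lemma blockASS k : blockA k.+2 = blockA k.+1 ++ blockA k.+1 ++ [:: 1].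
Proof. by []. Qed.

Lemma size_blockA k : size (blockA k) = 2 ^ k - 1.
Proof.
elim: k => [|[|k] IH] //.
rewrite blockASS !size_cat IH /= [in RHS]expnS.
have : 0 < 2 ^ k.+1 by rewrite expn_gt0.
lia.
Qed.

Lemma nth_blockAS k i : i < size (blockA k) ->
  nth 0 (blockA k.+1) i = nth 0 (blockA k) i.
Proof. by case: k => [|k] // ik; rewrite blockASS nth_cat ik. Qed.

Lemma nth_blockA k k' i : k <= k' -> i < size (blockA k) ->
  nth 0 (blockA k') i = nth 0 (blockA k) i.
Proof.
move=> /subnK <- ik; elim: (k' - k) => [|d IH] //.
rewrite addSn nth_blockAS // size_blockA.
move: ik; rewrite size_blockA => ik; apply: leq_trans ik _.
by rewrite leq_sub2r // leq_exp2l // leq_addl.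
Qed.

Lemma leq_size_blockA n : n <= size (blockA n).
Proof. by rewrite size_blockA; have := ltn_expl n (isT : 1 < 2); lia. Qed.

Lemma a_blockA k n : 0 < n <= size (blockA k) -> a n = nth 0 (blockA k) n.-1.
Proof.
case: n => [|n] //= nk; have nn := leq_size_blockA n.+1.
have [kn|/ltnW nk'] := leqP n.+1 k; first by rewrite (nth_blockA kn).
by rewrite -/(blockA n.+1) (nth_blockA nk').
Qed.

Lemma blockA_gt0 k : all (leq 1) (blockA k).
Proof. by elim: k => [|[|k] IH] //; rewrite blockASS !all_cat IH. Qed.

Lemma a_gt0 n : 0 < n -> 0 < a n.
Proof.
case: n => [|n] // _; apply: (allP (blockA_gt0 n.+1)).
exact/mem_nth/leq_size_blockA.
Qed.

Lemma leq_s n : n <= s n.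
Proof.
rewrite /s; elim: n => [|n IH] //.
by rewrite big_nat_recr // -[X in X <= _]addn1 leq_add // a_gt0.
Qed.

Lemma s_leq_ex m : exists n, s n <= m.
Proof. by exists 0; rewrite /s big_nat1. Qed.

Lemma s_leq_bound m n : s n <= m -> n <= m.
Proof. exact/leq_trans/leq_s. Qed.

Definition s_inv (m : nat) : nat := ex_maxn (s_leq_ex m) (@s_leq_bound m).

Definition M (i : nat) : nat := 2 ^ i - 1.

Definition mu (i : nat) : nat := 3 * M i + 2.

(* max {i >= 1 | mu i <= n}, and 0 if n <= 4; the range i <= n suffices since
   i <= mu i (see mu_top_max). *)
Definition mu_top (n : nat) : nat := \max_(1 <= i < n.+1 | mu i <= n) i.

(* Greedy mu-expansion of n: the remainder r and the coefficients
   i |-> epsilon_i. Each round decreases n, so fuel n is enough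
   (see mu_expansionE). *)
Fixpoint mu_greedy (fuel n : nat) : nat * (nat -> nat) :=
  if n <= 4 then (n, fun=> 0) else
  if fuel is fuel'.+1 then
    let l := mu_top n in
    let r' := n - mu l in
    if r' == 0 then (0, fun i => if i == l then 1 else 0)
    else if r' == mu l then (0, fun i => if i == l then 2 else 0)
    else let: (r, eps) := mu_greedy fuel' r' in
         (r, fun i => if i == l then 1 else eps i)
  else (n, fun=> 0).

Definition mu_expansion (n : nat) : nat * (nat -> nat) := mu_greedy n n.

Definition mu_coef (n i : nat) : nat := (mu_expansion n).2 i.

Definition phi (n : nat) : nat := \sum_(1 <= i < (mu_top n).+1) mu_coef n i.

Lemma muE i : mu i = 3 * 2 ^ i - 1.
Proof. by rewrite /mu /M; have : 0 < 2 ^ i; [rewrite expn_gt0|lia]. Qed.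

Lemma muS i : mu i.+1 = (mu i).*2.+1.
Proof. by rewrite !muE expnS; have : 0 < 2 ^ i; [rewrite expn_gt0|lia]. Qed.

Lemma leq_mu i : i <= mu i.
Proof. by rewrite muE; have := ltn_expl i (isT : 1 < 2); lia. Qed.

Lemma mu_top_max n i : 0 < i -> mu i <= n -> i <= mu_top n.
Proof.
move=> i0 mui; rewrite /mu_top; apply: (@leq_bigmax_seq _ _ _ id) => //.
by rewrite mem_index_iota i0 ltnS (leq_trans (leq_mu i)).
Qed.

Lemma mu_topP n : 4 < n -> 0 < mu_top n /\ mu (mu_top n) <= n < mu (mu_top n).+1.
Proof.
move=> n4; have t0 : 0 < mu_top n by apply: (@mu_top_max n 1).
split=> //; apply/andP; split; last first.
  by rewrite ltnNge; apply/negP => /mu_top_max; rewrite ltnn => /(_ isT).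
move: t0; rewrite /mu_top.
apply: (big_ind (fun t => 0 < t -> mu t <= n)) => // x y hx hy.
by rewrite /maxn; case: ifP.
Qed.

Lemma mu_top_small n : n <= 4 -> mu_top n = 0.
Proof.
move=> n4; rewrite /mu_top big_nat_cond big_pred0 // => i.
apply/negbTE/negP => /andP[/andP[i0 _]].
case: i i0 => // i _; rewrite muS.
have : 2 <= mu i by rewrite /mu leq_addl.
lia.
Qed.

Lemma mu_gt0 i : 0 < mu i.
Proof. by rewrite /mu addn2. Qed.

Lemma mu_greedy_fuel f n : n <= f -> mu_greedy f n = mu_greedy n n.
Proof.
elim/ltn_ind: n f => n IH f nf.
case: n IH nf => [|n] IH nf; first by case: f nf.
case: f nf => // f nf; rewrite /=; case: leqP => // n4.
have h : n.+1 - mu (mu_top n.+1) <= n by have := mu_gt0 (mu_top n.+1); lia.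
by rewrite (IH _ _ f) ?(IH _ _ n) // (leq_trans h).
Qed.

Lemma mu_expansionE n : mu_expansion n =
  if n <= 4 then (n, fun=> 0) else
  let l := mu_top n in
  let r' := n - mu l in
  if r' == 0 then (0, fun i => if i == l then 1 else 0)
  else if r' == mu l then (0, fun i => if i == l then 2 else 0)
  else let: (r, eps) := mu_expansion r' in
       (r, fun i => if i == l then 1 else eps i).
Proof.
case: n => // n; rewrite /mu_expansion [LHS]/=; case: leqP => // n4 /=.
rewrite mu_greedy_fuel //; have := mu_gt0 (mu_top n.+1); lia.
Qed.

Lemma mu_expansion_sum n :
  n = (mu_expansion n).1
      + \sum_(1 <= i < (mu_top n).+1) mu_coef n i * mu i.
Proof.
rewrite /mu_coef; elim/ltn_ind: n => n IH; rewrite mu_expansionE.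
case: leqP => n4; first by rewrite mu_top_small // big_geq // addn0.
have [l0 /andP[ln nl]] := mu_topP n4; rewrite muS in nl.
set l := mu_top n in l0 ln nl *; cbv zeta.
have sumE (c : nat) (e : nat -> nat) :
    \sum_(1 <= i < l.+1) (if i == l then c else e i) * mu i
    = \sum_(1 <= i < l) e i * mu i + c * mu l.
  rewrite big_nat_recr //= eqxx; congr (_ + _).
  by apply: eq_big_nat => i /andP[_ il]; rewrite ltn_eqF.
have sum0 : \sum_(1 <= i < l) 0 * mu i = 0 by rewrite big1.
case: eqP => [r0|r0] /=; first by rewrite (sumE 1 (fun=> 0)) sum0; lia.
case: eqP => [rl|rl] /=; first by rewrite (sumE 2 (fun=> 0)) sum0; lia.
have rn : n - mu l < n by have := mu_gt0 l; lia.
have := IH _ rn.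
case E: (mu_expansion (n - mu l)) => [r e] /= IHr.
rewrite sumE.
have tl : mu_top (n - mu l) < l.
  have [r4|r4] := leqP (n - mu l) 4; first by rewrite mu_top_small.
  have [t0 /andP[tr _]] := mu_topP r4.
  rewrite ltnNge; apply/negP => lt.
  have : mu l <= mu (mu_top (n - mu l)).
    by move: (mu_top _) lt => t lt; rewrite !muE leq_sub2r // leq_mul2l leq_exp2l.
  lia.
have zero i : mu_top (n - mu l) < i -> e i = 0.
  have -> : e = (mu_expansion (n - mu l)).2 by rewrite E.
  elim/ltn_ind: (n - mu l) {E IHr tl rn r0 rl} i => k IHk i ti.
  rewrite mu_expansionE; case: leqP => // k4; cbv zeta.
  have [t0 /andP[tk kt]] := mu_topP k4.
  have til : (i == mu_top k) = false by rewrite gtn_eqF.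
  case: eqP => [_|_] /=; first by rewrite til.
  case: eqP => [_|_] /=; first by rewrite til.
  have rk : k - mu (mu_top k) < k by have := mu_gt0 (mu_top k); lia.
  have := IHk _ rk i.
  case: (mu_expansion _) => r' e' /=; rewrite til; apply.
  apply: leq_trans ti; rewrite ltnS.
  have [r4|r4] := leqP (k - mu (mu_top k)) 4; first by rewrite mu_top_small.
  have [u0 /andP[ur _]] := mu_topP r4.
  by apply: mu_top_max => //; apply: leq_trans ur (leq_subr _ _).
have -> : \sum_(1 <= i < l) e i * mu i
        = \sum_(1 <= i < (mu_top (n - mu l)).+1) e i * mu i.
  rewrite (big_cat_nat _ (n := (mu_top (n - mu l)).+1)) //=.
  rewrite [X in _ + X]big_nat_cond [X in _ + X]big1 ?addn0 //.
  by move=> i /andP[/andP[ti _] _]; rewrite zero.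
lia.
Qed.

(* Main.v *)
Require Import Defs.
From mathcomp Require Import all_boot all_order all_algebra.
From mathcomp Require Import zify.

Set Implicit Arguments.
Unset Strict Implicit.

(** The block [A_l] has length [M_l] and sum [mu_l], and [A_(l+1)] is two copies
    of [A_l] followed by [1]; hence [s (M_l + j) = mu_l + s j] for [j <= M_l].
    Removing the greedy term [mu_l] from [m] therefore lowers [s_inv m] by [M_l]
    and [phi m] by [1], and [mu_l = 3 M_l + 2]; induct on [m]. *)

Lemma size_blockA_M k : size (blockA k) = M k.
Proof. exact: size_blockA. Qed.

Lemma MS l : M l.+1 = (M l).*2.+1.
Proof. by rewrite /M expnS; have : 0 < 2 ^ l; [rewrite expn_gt0|lia]. Qed.

Lemma leq_mu2 i j : (mu i <= mu j) = (i <= j).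
Proof. by rewrite /mu leq_add2r leq_pmul2l // /M leq_sub2rE ?expn_gt0 // leq_exp2l. Qed.

Lemma s0 : s 0 = 0.
Proof. by rewrite /s big_nat1. Qed.

Lemma sS n : s n.+1 = s n + a n.+1.
Proof. by rewrite /s big_nat_recr. Qed.

Lemma leq_s2 i j : i <= j -> s i <= s j.
Proof.
move=> /subnK <-; elim: (j - i) => [|d IH] //.
by rewrite addSn sS (leq_trans IH) ?leq_addr.
Qed.

Lemma s_sumn_take k n : n <= M k -> s n = sumn (take n (blockA k)).
Proof.
rewrite -size_blockA_M; elim: n => [|n IH] nk; first by rewrite s0 take0.
by rewrite sS IH 1?ltnW // (a_blockA (k := k)) ?nk // (take_nth 0) // sumn_rcons.
Qed.

(** Both sides start at 5 and obey the recursion [x] to [2x + 1]. *)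
Lemma sumn_blockA k : 0 < k -> sumn (blockA k) = mu k.
Proof.
case: k => // k _; elim: k => [|k IH] //.
by rewrite blockASS !sumn_cat IH [RHS]muS /=; lia.
Qed.

Lemma s_M l : 0 < l -> s (M l) = mu l.
Proof.
by move=> l0; rewrite (s_sumn_take (k := l)) // -size_blockA_M take_size sumn_blockA.
Qed.

Lemma s_addM l j : 0 < l -> j <= M l -> s (M l + j) = mu l + s j.
Proof.
(* With [l] now shifted by one, the prefix lies within the two copies of [blockA l.+1] and never
   reaches the final 1 of [blockA l.+2]. *)
case: l => // l _ jl; rewrite (s_sumn_take (k := l.+2)); last by rewrite [M l.+2]MS; lia.
rewrite blockASS take_cat size_blockA_M ifN -?leqNgt ?leq_addr // addKn.
rewrite sumn_cat sumn_blockA // takel_cat ?size_blockA_M //.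
by rewrite -s_sumn_take.
Qed.

Lemma s_inv_bounds m : s (s_inv m) <= m < s (s_inv m).+1.
Proof.
rewrite /s_inv; case: ex_maxnP => n -> max_n /=.
by rewrite ltnNge; apply/negP => /max_n; rewrite ltnn.
Qed.

Lemma s_inv_eq m n : s n <= m < s n.+1 -> s_inv m = n.
Proof.
have /andP[lo hi] := s_inv_bounds m; case/andP=> lo' hi'.
case: (ltngtP (s_inv m) n) => // /leq_s2 h; first by have := leq_trans hi h; lia.
by have := leq_trans hi' h; lia.
Qed.

Lemma s_inv_small m : m <= 4 -> s_inv m = 0.
Proof. by move=> m4; apply: s_inv_eq; rewrite sS s0 /=; lia. Qed.

Lemma s_inv_add_mu l r : 0 < l -> r <= mu l -> s_inv (mu l + r) = M l + s_inv r.
Proof.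
move=> l0 rl; have /andP[lo hi] := s_inv_bounds r.
(* Entries are positive, so [s (M l).+1] exceeds [s (M l) = mu l >= r]. *)
have nl : s_inv r <= M l.
  rewrite leqNgt; apply/negP => /leq_s2; rewrite sS s_M //.
  by have := a_gt0 (isT : 0 < (M l).+1); lia.
apply: s_inv_eq; rewrite s_addM // -[(M l + _).+1]addnS leq_add2l lo /=.
(* If [s_inv r = M l], the next index is out of reach of [s_addM], but it equals [M l.+1], where [s]
   takes the value [2 * mu l + 1 > mu l + r]. *)
case: (ltngtP (s_inv r) (M l)) nl => // [nl|nE] _.
  by rewrite s_addM // ltn_add2l.
by rewrite nE addnS addnn -MS s_M // muS; lia.
Qed.

Lemma mu_top_eq n l : 0 < l -> mu l <= n < mu l.+1 -> mu_top n = l.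
Proof.
move=> l0 /andP[ln nl]; apply/eqP; rewrite eqn_leq (mu_top_max l0 ln) andbT.
(* Here [mu 1 = 5] is the least term. *)
have n4 : 4 < n by rewrite (leq_trans _ ln) // (leq_mu2 1).
have [t0 /andP[tn _]] := mu_topP n4.
by rewrite -ltnS ltnNge -leq_mu2 -ltnNge (leq_ltn_trans tn).
Qed.

Lemma mu_top_lt l r : 0 < l -> r < mu l -> mu_top r < l.
Proof.
move=> l0 rl; have [r4|r4] := leqP r 4; first by rewrite mu_top_small.
have [_ /andP[tr _]] := mu_topP r4.
by rewrite ltnNge -leq_mu2 -ltnNge (leq_ltn_trans tr).
Qed.

Lemma mu_coef_small n i : n <= 4 -> mu_coef n i = 0.
Proof. by move=> n4; rewrite /mu_coef mu_expansionE n4. Qed.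

Lemma mu_coef_add_mu l r i : 0 < l -> r < mu l ->
  mu_coef (mu l + r) i = if i == l then 1 else mu_coef r i.
Proof.
move=> l0 rl; rewrite {1}/mu_coef mu_expansionE.
have l4 : 4 < mu l by rewrite (leq_mu2 1).
rewrite leqNgt (leq_trans l4 (leq_addr _ _)) /= (@mu_top_eq _ l) //; last first.
  by rewrite muS; lia.
(* The early stop at [r = 0] agrees with the recursive branch, since 0 has only zero
   coefficients. *)
rewrite addKn (ltn_eqF rl); case: eqP => [->|_] /=; first by rewrite mu_coef_small.
by rewrite /mu_coef; case: (mu_expansion r).
Qed.

Lemma mu_coef_double l i : 0 < l ->
  mu_coef (mu l + mu l) i = if i == l then 2 else 0.
Proof.
move=> l0; rewrite /mu_coef mu_expansionE.
have l4 : 4 < mu l by rewrite (leq_mu2 1).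
rewrite leqNgt (leq_trans l4 (leq_addr _ _)) /= (@mu_top_eq _ l) //; last first.
  by rewrite muS; lia.
by rewrite addKn eqxx; case: eqP => // l00; move: l4; rewrite l00.
Qed.

(** The greedy indices strictly decrease: a remainder below [mu l] has its top below [l], and a
    remainder equal to [mu l] ends the process. *)
Lemma mu_coef_gt_top n i : mu_top n < i -> mu_coef n i = 0.
Proof.
elim/ltn_ind: n => n IH ti.
have [n4|n4] := leqP n 4; first by rewrite mu_coef_small.
have [l0 /andP[ln nl]] := mu_topP n4.
set l := mu_top n in ti l0 ln nl.
have il : (i == l) = false by rewrite gtn_eqF.
have l_gt0 := mu_gt0 l.
move: nl; rewrite -(subnKC ln) muS; set r := n - mu l => nl.
case: (ltngtP r (mu l)) => [rl|rl|->]; last by rewrite mu_coef_double // il.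
  rewrite mu_coef_add_mu // il; apply: IH; first by rewrite /r; lia.
  exact: ltn_trans (mu_top_lt l0 rl) ti.
by lia.
Qed.

(** Gives [phi r] and [phi (mu l + r)] a common summation range. *)
Lemma phi_widen n k : mu_top n <= k -> phi n = \sum_(1 <= i < k.+1) mu_coef n i.
Proof.
move=> tk; rewrite /phi (big_cat_nat (n := (mu_top n).+1) (p := k.+1)) //=.
rewrite [X in _ + X]big_nat_cond [X in _ + X]big1 ?addn0 //.
by move=> i /andP[/andP[ti _] _]; rewrite mu_coef_gt_top.
Qed.

Lemma phi_small n : n <= 4 -> phi n = 0.
Proof. by move=> n4; rewrite /phi mu_top_small // big_geq. Qed.

Lemma phi_add_mu_lt l r : 0 < l -> r < mu l -> phi (mu l + r) = (phi r).+1.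
Proof.
case: l => // l l0 rl; rewrite {1}/phi (@mu_top_eq _ l.+1) //; last by rewrite [mu l.+2]muS; lia.
rewrite big_nat_recr //= mu_coef_add_mu // eqxx addn1; congr _.+1.
rewrite (phi_widen (k := l)); last exact: mu_top_lt rl.
by apply: eq_big_nat => i /andP[_ il]; rewrite mu_coef_add_mu // ltn_eqF.
Qed.

Lemma phi_add_mu l r : 0 < l -> r <= mu l -> phi (mu l + r) = (phi r).+1.
Proof.
move=> l0; rewrite leq_eqVlt => /predU1P[->|]; last exact: phi_add_mu_lt.
(* In the boundary case [r = mu l], the single coefficient 2 of [2 * mu l] matches
   [phi (mu l) + 1]. *)
have -> : phi (mu l) = 1 by rewrite -[mu l]addn0 phi_add_mu_lt ?mu_gt0 // phi_small.
case: l l0 => // l l0; rewrite /phi (@mu_top_eq _ l.+1) //; last by rewrite [mu l.+2]muS; lia.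
rewrite big_nat_recr //= mu_coef_double // eqxx big_nat_cond big1 //.
by move=> i /andP[/andP[_ il] _]; rewrite mu_coef_double // ltn_eqF.
Qed.

Lemma s_inv_phi m : exists2 r, r <= 4 & m = 3 * s_inv m + 2 * phi m + r.
Proof.
elim/ltn_ind: m => m IH.
have [m4|m4] := leqP m 4; first by exists m; rewrite ?s_inv_small ?phi_small.
have [l0 /andP[lm ml]] := mu_topP m4.
set l := mu_top m in l0 lm ml; have l_gt0 := mu_gt0 l.
have ltm : m - mu l < m by lia.
have rl : m - mu l <= mu l by move: ml; rewrite muS; lia.
(* The same [r] serves [m]: restoring [mu l] adds [3 * M l + 2 * 1], which is exactly [mu l], to the
   right-hand side. *)
have [r r4 mE] := IH _ ltm; exists r => //.
rewrite -[in s_inv m](subnKC lm) -[in phi m](subnKC lm).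
by rewrite s_inv_add_mu // phi_add_mu //; move: lm mE; rewrite /mu; lia.
Qed.

Unset Implicit Arguments.

Theorem theorem5p1 (m : nat) (hm : 0 < m) :
  exists r : nat,
    r <= 4 /\
    (m%:Z - r%:Z = 3%:Z * (s_inv m)%:Z + 2%:Z * (phi m)%:Z)%R.
Proof. by have [r r4 mE] := s_inv_phi m; exists r; split=> //; lia. Qed.
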